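(* Let $\mathsf{DISJ}_n:\{0,1\}^n\times\{0,1\}^n\to\{0,1\}$ be defined by $\mathsf{DISJ}_n(x,y)=\bigvee_{i=1}^n(x_i\wedge y_i)$. Then, as $n\to\infty$, $$\log\widetilde{\mathrm{rank}}(\mathsf{DISJ}_n)=\Omega(\sqrt n)\qquad\text{and}\qquad \log\widetilde{\gamma}_2(\mathsf{DISJ}_n)=\Omega(\sqrt n).$$
   Context: For a real matrix $A$, $\gamma_2(A)=\min_{B,C:\,BC=A}\|B\|_{\mathrm{row}}\|C\|_{\mathrm{col}}$, where $\|B\|_{\mathrm{row}}$ is the largest $\ell_2$ norm of a row of $B$ and $\|C\|_{\mathrm{col}}$ is the largest $\ell_2$ norm of a column of $C$. For finite sets $\mathcal X,\mathcal Y$, a function $F:\mathcal X\times\mathcal Y\to\{0,1\}$ is identified with its sign matrix, whose $(x,y)$ entry is $(-1)^{1-F(x,y)}$. A real $\mathcal X\times\mathcal Y$ matrix $A$ approximates $F$ to error $\epsilon$ if $|A_{xy}-(-1)^{1-F(x,y)}|\le\epsilon$ and $|A_{xy}|\le1$ for all $(x,y)$. $\widetilde{\mathrm{rank}}(F)$ and $\widetilde{\gamma}_2(F)$ denote the minimum of $\mathrm{rank}(A)$, respectively $\gamma_2(A)$, over all $A$ approximating $F$ to error $2/3$. $h(n)=\Omega(\sqrt n)$ means that there are $c>0$ and $n_0$ with $h(n)\ge c\sqrt n$ for all $n\ge n_0$. Logarithms are base 2. *)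

(* Defs.v *)
From HB Require Import structures.
From mathcomp Require Import all_boot all_order all_algebra.
From mathcomp Require Import boolp classical_sets reals exp.

Set Implicit Arguments.
Unset Strict Implicit.
Unset Printing Implicit Defensive.

Import Order.TTheory GRing.Theory Num.Theory.

Local Open Scope classical_set_scope.
Local Open Scope ring_scope.

Definition log2 (R : realType) (x : R) : R := ln x / ln 2.

(* Norms are nonnegative, so 0 is a neutral starting value for the maxima. *)
Definition row_norm (R : realType) (m n : nat) (B : 'M[R]_(m, n)) : R :=
  \big[Num.max/0]_(i < m) Num.sqrt (\sum_(j < n) B i j ^+ 2).

Definition col_norm (R : realType) (m n : nat) (C : 'M[R]_(m, n)) : R :=
  \big[Num.max/0]_(j < n) Num.sqrt (\sum_(i < m) C i j ^+ 2).

(* The inner dimension k of a factorization is arbitrary. The set is nonempty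
   (A = A *m 1%:M) and bounded below by 0, and its minimum is attained, so
   the infimum below is that minimum. *)
Definition gamma2 (R : realType) (m n : nat) (A : 'M[R]_(m, n)) : R :=
  inf [set g : R | exists (k : nat) (B : 'M[R]_(m, k)) (C : 'M[R]_(k, n)),
         B *m C = A /\ g = row_norm B * col_norm C].

(* X x Y matrices are indexed through the enumerations of X and Y. *)
Definition sign_mx (R : realType) (X Y : finType) (F : X -> Y -> bool) :
    'M[R]_(#|X|, #|Y|) :=
  \matrix_(i, j) (-1) ^+ (1 - F (enum_val i) (enum_val j))%N.

Definition approximates (R : realType) (X Y : finType) (eps : R)
    (F : X -> Y -> bool) (A : 'M[R]_(#|X|, #|Y|)) : Prop :=
  forall i j, `|A i j - sign_mx R F i j| <= eps /\ `|A i j| <= 1.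

Lemma approximates_sign_mx (R : realType) (X Y : finType) (eps : R)
    (F : X -> Y -> bool) :
  0 <= eps -> approximates eps F (sign_mx R F).
Proof.
move=> eps0 i j; split; first by rewrite subrr normr0.
by rewrite mxE normrX normrN1 expr1n.
Qed.

Lemma approx_rank_ex (R : realType) (X Y : finType) (F : X -> Y -> bool) :
  exists r, `[< exists A : 'M[R]_(#|X|, #|Y|),
                  approximates (2 / 3) F A /\ \rank A = r >].
Proof.
exists (\rank (sign_mx R F)); apply/asboolP; exists (sign_mx R F); split=> //.
by apply: approximates_sign_mx; rewrite divr_ge0.
Qed.

Definition approx_rank (R : realType) (X Y : finType) (F : X -> Y -> bool) :
    nat :=
  ex_minn (approx_rank_ex R F).

(* The minimum is attained: the approximating matrices form a nonempty compact
   set, on which gamma2 is continuous. *)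
Definition approx_gamma2 (R : realType) (X Y : finType) (F : X -> Y -> bool) :
    R :=
  inf [set gamma2 A | A in [set A : 'M[R]_(#|X|, #|Y|) |
                              approximates (2 / 3) F A]].

(* The value is true exactly when x and y intersect. *)
Definition DISJ (n : nat) (x y : n.-tuple bool) : bool :=
  \big[orb/false]_(i < n) (tnth x i && tnth y i).

Definition Omega_sqrt (R : realType) (h : nat -> R) : Prop :=
  exists2 c : R, 0 < c &
    exists n0 : nat, forall n : nat, (n0 <= n)%N -> c * Num.sqrt n%:R <= h n.

(* Main.v *)
(* For k blocks of two bits, let x be a choice of two bits per block and y a
   choice of one of the four literals on those bits per block.  DISJ on 4k
   coordinates contains the matrix telling whether some chosen literal is true.
   The matrices M_t = prod_i (1 + t (-1)^hit_i) are, up to a factor 16^-k,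
   probability distributions under which the chosen literals are independent
   and true with probability (1 - t) / 2; M_1 lives on the disjoint pairs, and
   M_t gives them exponentially small mass as soon as t is away from 1.
   Combine them into W = M_1 - sum_i w_i M_(t_i), where w_i are the weights of
   Lagrange interpolation at t = 1 from m + 1 nodes t_i: as sum_i w_i t_i^s = 1
   for s <= m, all the components of W of order at most m cancel, and since a
   component of order s has operator norm 2^(-s/2) times the trivial one, W has
   small operator norm.  For nodes at 1 - 2z/m^2 with z = 1/8, 1, 4, ..., m^2
   the weights have total size at most 11/6, so W still correlates with every
   matrix approximating DISJ.  Rank and gamma_2 are then bounded below by the
   ratio of this correlation to the operator norm. *)

Require Import Defs.
From mathcomp Require Import all_boot all_order all_algebra.
From mathcomp Require Import boolp classical_sets reals exp ring lra zify.

Set Implicit Arguments.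
Unset Strict Implicit.
Unset Printing Implicit Defensive.

Import Order.TTheory GRing.Theory Num.Theory.

Local Open Scope ring_scope.

(** * Pattern matrices *)

(** Nested pairs, so that [sum_block] peels off one block at a time. Rows and columns share the
    type: the same two booleans are read as two bits or as a literal. *)
Fixpoint cube (k : nat) : finType :=
  if k is k'.+1 then ((bool * bool) * cube k')%type else unit.

Lemma card_cube k : #|cube k| = (4 ^ k)%N.
Proof. by elim: k => [|k IHk]; rewrite ?card_unit // !card_prod card_bool IHk expnS. Qed.

(* [y = (v, w)] designates the literal x_v, negated when [w] is true. *)
Definition hit (x y : bool * bool) : bool := (if y.1 then x.2 else x.1) (+) y.2.

Fixpoint overlap k : cube k -> cube k -> bool :=
  if k is k'.+1 then fun x y => hit x.1 y.1 || overlap x.2 y.2 else fun _ _ => false.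

Section Pattern.
Variable R : realType.

(* [L] bounds the square of the operator norm of [W]. *)
Definition opsq (X Y : finType) (W : X -> Y -> R) (L : R) : Prop :=
  forall v : Y -> R,
    \sum_x (\sum_y W x y * v y) ^+ 2 <= L * \sum_y v y ^+ 2.

(* [pat c x y] is the sum over sets S of blocks of
   c_|S| * prod_(i in S) (-1)^(hit x_i y_i). *)
Fixpoint pat k (c : nat -> R) : cube k -> cube k -> R :=
  if k is k'.+1 then
    fun x y => pat c x.2 y.2 + (-1) ^+ hit x.1 y.1 * pat (fun s => c s.+1) x.2 y.2
  else fun _ _ => c 0%N.

Lemma sum_unit (F : unit -> R) : \sum_x F x = F tt.
Proof. by rewrite (big_pred1 tt) // => -[]. Qed.

Lemma sum_block (T : finType) (F : (bool * bool) * T -> R) :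
  \sum_p F p = \sum_t (F ((true, true), t) + F ((true, false), t) +
                       F ((false, true), t) + F ((false, false), t)).
Proof.
rewrite (eq_bigr (fun p => F (p.1, p.2))) => [|[]] //.
rewrite -(pair_bigA _ (fun a b => F (a, b))) exchange_big.
apply: eq_bigr => t _ /=.
rewrite (eq_bigr (fun p => F ((p.1, p.2), t))) => [|[]] //.
rewrite -(pair_bigA _ (fun a b => F ((a, b), t))) !big_bool /=.
by rewrite !addrA.
Qed.

(* The 4 x 4 matrices J (all ones) and H = (-1)^hit satisfy J^T H = H J^T = 0,
   so the operator norm of J (x) A + H (x) B is the larger of 4 |A| and
   sqrt 8 |B|. *)
Lemma opsq_block (X Y : finType) (A B : X -> Y -> R) (a : R) : 0 <= a ->
  opsq A a -> opsq B (2 * a) ->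
  opsq (fun (x : (bool * bool) * X) (y : (bool * bool) * Y) =>
          A x.2 y.2 + (-1) ^+ hit x.1 y.1 * B x.2 y.2) (a * 16).
Proof.
move=> a0 hA hB v.
pose V y := v ((true, true), y) + v ((true, false), y) +
            v ((false, true), y) + v ((false, false), y).
pose D b y := v ((b, false), y) - v ((b, true), y).
pose al x := \sum_y A x y * V y.
pose be b x := \sum_y B x y * D b y.
have inner x : \sum_y (A x.2 y.2 + (-1) ^+ hit x.1 y.1 * B x.2 y.2) * v y =
   al x.2 + (-1) ^+ x.1.1 * be false x.2 + (-1) ^+ x.1.2 * be true x.2.
  rewrite sum_block /al /be !mulr_sumr -!big_split /=.
  apply: eq_bigr => y _; rewrite /hit /V /D /=.
  by case: x => [[[] []] x] /=; ring.
under eq_bigr => x _ do rewrite inner.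
rewrite !sum_block /=.
(* The two bits of the block run over all sign choices, so the cross terms cancel. *)
rewrite (eq_bigr (fun x => 4 * (al x ^+ 2 + be false x ^+ 2 + be true x ^+ 2)));
  last by move=> x _; ring.
rewrite -mulr_sumr !big_split /=.
have h1 := hA V; have h2 := hB (D false); have h3 := hB (D true).
apply: (@le_trans _ _ (4 * (a * (\sum_y (V y ^+ 2 + 2 * D false y ^+ 2 + 2 * D true y ^+ 2))))).
  rewrite !big_split /= -!mulr_sumr; rewrite /al /be; lra.
rewrite mulrCA -mulrA ler_wpM2l // -!big_split /=.
rewrite !mulr_sumr ler_sum // => y _.
rewrite /V /D.
set p := v _; set q := v _; set r := v _; set s := v _.
(* V^2 + 2 D_false^2 + 2 D_true^2 + (p + q - r - s)^2 = 4 (p^2 + q^2 + r^2 + s^2). *)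
have := sqr_ge0 (p + q - r - s); nra.
Qed.

(** The shifted coefficients satisfy the hypothesis with 2K in place of K, which is exactly the
    slack that [opsq_block] grants to its second matrix. *)
Lemma opsq_pat k (c : nat -> R) (K : R) :
  (forall s, c s ^+ 2 <= K * 2 ^+ s) -> opsq (pat (k := k) c) (K * 16 ^+ k).
Proof.
elim: k c K => [|k IHk] c K hc.
  move=> v; rewrite expr0 mulr1 !sum_unit exprMn.
  by rewrite ler_wpM2r ?sqr_ge0 //; have := hc 0%N; rewrite mulr1.
have K0 : 0 <= K by have := hc 0%N; rewrite mulr1; apply: le_trans; exact: sqr_ge0.
rewrite exprSr mulrA.
apply: opsq_block; first by rewrite mulr_ge0 ?exprn_ge0.
- exact: IHk.
- rewrite mulrA; apply: IHk => s; apply: le_trans (hc s.+1) _.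
  by rewrite exprS; lra.
Qed.

Lemma eq_pat k (c d : nat -> R) : c =1 d -> pat (k := k) c =2 pat d.
Proof.
elim: k c d => [|k IHk] c d e x y /=; first by rewrite e.
by rewrite (IHk c d) // (IHk (fun s => c s.+1) (fun s => d s.+1)) // => s; rewrite e.
Qed.

Lemma pat_lin k (a b : R) (c d : nat -> R) (x y : cube k) :
  pat (fun s => a * c s + b * d s) x y = a * pat c x y + b * pat d x y.
Proof.
elim: k c d x y => [|k IHk] c d x y //=; rewrite !IHk.
by ring.
Qed.

Lemma pat_sum (I : finType) k (w : I -> R) (c : I -> nat -> R) (x y : cube k) :
  pat (fun s => \sum_i w i * c i s) x y = \sum_i w i * pat (c i) x y.
Proof.
elim: k c x y => [|k IHk] c x y //=; rewrite !IHk mulr_sumr -big_split /=.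
by apply: eq_bigr => i _; ring.
Qed.

Lemma pat_exp_shift k (t : R) (x y : cube k) :
  pat (fun s => t ^+ s.+1) x y = t * pat (GRing.exp t) x y.
Proof.
rewrite -[RHS]addr0 -(mul0r (pat (GRing.exp t) x y)) -pat_lin.
by apply: eq_pat => s; rewrite exprS mul0r addr0.
Qed.

(** Geometric coefficients make [pat] the product matrix M_t. *)
Lemma pat_expS k (t : R) (x y : cube k.+1) :
  pat (GRing.exp t) x y = (1 + t * (-1) ^+ hit x.1 y.1) * pat (GRing.exp t) x.2 y.2.
Proof. by rewrite /= pat_exp_shift; ring. Qed.

Lemma pat_exp_ge0 k (t : R) (x y : cube k) : -1 <= t <= 1 -> 0 <= pat (GRing.exp t) x y.
Proof.
move=> /andP[t1 t2]; elim: k x y => [|k IHk] x y; first exact: ler01.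
by rewrite pat_expS mulr_ge0 //; case: hit; lra.
Qed.

Lemma sum_pat_exp k (t : R) : \sum_x \sum_y pat (k := k) (GRing.exp t) x y = 16 ^+ k.
Proof.
elim: k => [|k IHk]; first by rewrite !sum_unit.
rewrite exprS -IHk sum_block mulr_sumr; apply: eq_bigr => x _.
rewrite !sum_block mulr_sumr -!big_split; apply: eq_bigr => y _ /=.
by rewrite pat_exp_shift /hit /=; ring.
Qed.

(** In each block 8 of the 16 pairs are without a hit, and each of them has weight 1 + t. *)
Lemma sum_pat_exp_disj k (t : R) :
  \sum_x \sum_y (~~ overlap x y)%:R * pat (k := k) (GRing.exp t) x y = (8 * (1 + t)) ^+ k.
Proof.
elim: k => [|k IHk]; first by rewrite !sum_unit /= mulr1.
rewrite exprS -IHk sum_block mulr_sumr; apply: eq_bigr => x _.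
rewrite !sum_block mulr_sumr -!big_split; apply: eq_bigr => y _ /=.
by rewrite pat_exp_shift /hit /=; ring.
Qed.
End Pattern.

(** * Rank and gamma_2 against the operator norm *)

Section Bounds.
Variable R : realType.

Lemma cauchy_schwarz (I : finType) (a b : I -> R) :
  (\sum_i a i * b i) ^+ 2 <= (\sum_i a i ^+ 2) * (\sum_i b i ^+ 2).
Proof.
have : 0 <= \sum_i \sum_j (a i * b j - a j * b i) ^+ 2.
  by apply: sumr_ge0 => i _; apply: sumr_ge0 => j _; exact: sqr_ge0.
rewrite (eq_bigr (fun i => a i ^+ 2 * (\sum_j b j ^+ 2) +
   (b i ^+ 2 * (\sum_j a j ^+ 2) + (- 2 * (a i * b i)) * \sum_j a j * b j))).
  rewrite !big_split /= -!mulr_suml -mulr_sumr; lra.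
move=> i _; rewrite !mulr_sumr -!big_split /=.
by apply: eq_bigr => j _; ring.
Qed.

(** Cauchy-Schwarz over the pairs (x, l), between b and the images under W of the vectors c_l. Rank
    and gamma_2 both use it, with different factorizations. *)
Lemma opsq_factor (X Y I : finType) (W : X -> Y -> R) (L : R)
    (b : X -> I -> R) (c : I -> Y -> R) : opsq W L ->
  (\sum_x \sum_y (\sum_l b x l * c l y) * W x y) ^+ 2 <=
  L * (\sum_x \sum_l b x l ^+ 2) * (\sum_l \sum_y c l y ^+ 2).
Proof.
move=> hW.
have -> : \sum_x \sum_y (\sum_l b x l * c l y) * W x y =
          \sum_(p : X * I) b p.1 p.2 * \sum_y W p.1 y * c p.2 y.
  rewrite -(pair_bigA _ (fun x l => b x l * \sum_y W x y * c l y)) /=.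
  apply: eq_bigr => x _.
  under eq_bigr do rewrite mulr_suml.
  rewrite exchange_big /=; apply: eq_bigr => l _; rewrite mulr_sumr.
  by apply: eq_bigr => y _; ring.
apply: le_trans (cauchy_schwarz _ _) _.
rewrite -(pair_bigA _ (fun x l => b x l ^+ 2)) /= mulrAC mulrC.
apply: ler_wpM2r; first by do 2 (apply: sumr_ge0 => ? _); exact: sqr_ge0.
rewrite -(pair_bigA _ (fun x l => (\sum_y W x y * c l y) ^+ 2)) /= exchange_big /=.
by rewrite mulr_sumr; apply: ler_sum => l _; exact: hW.
Qed.

Lemma sum_sqr_eq0 (I : finType) (a : I -> R) i : \sum_i a i ^+ 2 = 0 -> a i = 0.
Proof.
move=> /eqP; rewrite psumr_eq0 => [|j _]; last exact: sqr_ge0.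
by move=> /allP/(_ i (mem_index_enum _)); rewrite /= sqrf_eq0 => /eqP.
Qed.

Lemma mxtrace_mul_tr m n (A : 'M[R]_(m, n)) :
  \tr (A *m A^T) = \sum_i \sum_j A i j ^+ 2.
Proof.
by apply: eq_bigr => i _; rewrite mxE; apply: eq_bigr => j _; rewrite mxE expr2.
Qed.

(** If u C C^T = 0 then uC has squared norm u C C^T u^T = 0, hence u = 0. *)
Lemma gram_unit r n (C : 'M[R]_(r, n)) : row_free C -> C *m C^T \in unitmx.
Proof.
move=> Cfree; rewrite -row_free_unit -kermx_eq0.
apply/eqP/row_matrixP => i; rewrite row0.
set u := row i _.
have uG : u *m (C *m C^T) = 0 by rewrite -row_mul mulmx_ker row0.
have uC : u *m C = 0.
  have : \tr ((u *m C) *m (u *m C)^T) = 0.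
    by rewrite trmx_mul mulmxA -(mulmxA u) uG mul0mx mxtrace0.
  rewrite mxtrace_mul_tr big_ord1 => h.
  by apply/matrixP => a j; rewrite ord1 (sum_sqr_eq0 j h) mxE.
by apply: (row_free_inj Cfree); rewrite uC mul0mx.
Qed.

(* [P] is the orthogonal projection onto the row space of [C]. *)
Lemma row_free_projection r n (C : 'M[R]_(r, n)) : row_free C ->
  exists2 P : 'M[R]_n, C *m P = C & \sum_i \sum_j P i j ^+ 2 = r%:R.
Proof.
move=> /gram_unit; set G := C *m C^T => Gu.
have GT : G^T = G by rewrite trmx_mul trmxK.
exists (C^T *m invmx G *m C); first by rewrite !mulmxA -/G mulmxV // mul1mx.
(* P is symmetric and idempotent, so its squared Frobenius norm is tr P, which cyclicity turns into
   the trace of the identity of size r. *)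
rewrite -mxtrace_mul_tr !trmx_mul trmxK trmx_inv GT.
rewrite !mulmxA -(mulmxA _ C) -/G mulmxKV //.
by rewrite -mulmxA mxtrace_mulC -mulmxA mulVmx // mxtrace1.
Qed.

Lemma row_projection m n (A : 'M[R]_(m, n)) :
  exists2 P : 'M[R]_n, A *m P = A &
    \sum_i \sum_j P i j ^+ 2 = (\rank A)%:R.
Proof.
have [P CP <-] := row_free_projection (row_base_free A).
by exists P; rewrite // -{1}(mulmx_base A) -mulmxA CP mulmx_base.
Qed.

(** The factorization A = A P, with P the projection onto the row space of A, brings in the rank as
    the squared Frobenius norm of P. *)
Lemma opsq_rank m n (A : 'M[R]_(m, n)) (W : 'I_m -> 'I_n -> R) (L : R) :
  opsq W L ->
  (\sum_i \sum_j A i j * W i j) ^+ 2 <=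
  L * (\sum_i \sum_j A i j ^+ 2) * (\rank A)%:R.
Proof.
move=> hW; have [P AP <-] := row_projection A.
rewrite -{1}AP.
by under eq_bigr do under eq_bigr do rewrite mxE; exact: opsq_factor.
Qed.

Lemma mxrank_mxsub m n m' n' (f : 'I_m' -> 'I_m) (g : 'I_n' -> 'I_n)
  (A : 'M[R]_(m, n)) : (\rank (mxsub f g A) <= \rank A)%N.
Proof.
have -> : mxsub f g A = (rowsub f 1%:M) *m (A *m colsub g 1%:M).
  by rewrite mulmx_colsub mulmx1 mul_rowsub_mx mul1mx -mxsubrc.
exact: leq_trans (mxrankM_maxr _ _) (mxrankM_maxl _ _).
Qed.

Lemma row_norm_ge0 m n (B : 'M[R]_(m, n)) : 0 <= row_norm B.
Proof. exact: bigmax_ge_id. Qed.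

Lemma col_norm_ge0 m n (B : 'M[R]_(m, n)) : 0 <= col_norm B.
Proof. exact: bigmax_ge_id. Qed.

Lemma row_norm_sqr m n (B : 'M[R]_(m, n)) i :
  \sum_j B i j ^+ 2 <= row_norm B ^+ 2.
Proof.
rewrite -[leLHS]sqr_sqrtr; last by apply: sumr_ge0 => j _; exact: sqr_ge0.
rewrite ler_sqr ?nnegrE ?sqrtr_ge0 ?row_norm_ge0 //.
by rewrite /row_norm; exact: (le_bigmax _ (fun i => Num.sqrt (\sum_j B i j ^+ 2)) i).
Qed.

Lemma col_norm_sqr m n (C : 'M[R]_(m, n)) j :
  \sum_i C i j ^+ 2 <= col_norm C ^+ 2.
Proof.
rewrite -[leLHS]sqr_sqrtr; last by apply: sumr_ge0 => i _; exact: sqr_ge0.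
rewrite ler_sqr ?nnegrE ?sqrtr_ge0 ?col_norm_ge0 //.
by rewrite /col_norm; exact: (le_bigmax _ (fun j => Num.sqrt (\sum_i C i j ^+ 2)) j).
Qed.
End Bounds.

(** * Interpolation weights *)

Section Interpolation.
Variable R : realType.

Lemma lagrange_at0 (x : nat -> R) n (p : {poly R}) : injective x ->
  (size p <= n.+1)%N ->
  p.[0] = \sum_(i < n.+1) (\prod_(j < n.+1 | j != i) (x j / (x j - x i))) * p.[x i].
Proof.
move=> xinj sp.
rewrite {1}(lagrange_gen (ltn0Sn n) xinj sp) horner_sum; apply: eq_bigr => i _.
rewrite hornerM hornerC mulrC lagrangeE //=; congr (_ * _).
rewrite hornerM hornerC !horner_prod -prodfV -big_split /=.
apply: eq_bigr => j ji; rewrite !hornerXsubC sub0r mulrC -[x i - x j]opprB invrN mulrNN.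
by [].
Qed.

(** The node 1/8 replaces 0, the point of evaluation: it keeps every t_i away from 1, at the price
    of a weight slightly above 1. *)
Definition node (i : nat) : R := if i is 0%N then 8^-1 else (i ^ 2)%:R.

Lemma node_inj : injective node.
Proof.
move=> [|i] [|j] //=.
- move=> h; have : (1 : R) = (8 * j.+1 ^ 2)%:R by rewrite natrM -h; lra.
  by move=> /eqP; rewrite (eqr_nat _ 1) => /eqP; case: j {h} => [|j].
- move=> h; have : (1 : R) = (8 * i.+1 ^ 2)%:R by rewrite natrM h; lra.
  by move=> /eqP; rewrite (eqr_nat _ 1) => /eqP; case: i {h} => [|i].
- by move=> /eqP; rewrite eqr_nat eqn_sqr => /eqP.
Qed.

(** Telescoping: each term is at most 1/(i + 1/2) - 1/(i + 3/2) = 1/((i+1)^2 - 1/4). *)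
Lemma sum_inv_sqr m :
  \sum_(i < m) ((i.+1 ^ 2)%:R - 8^-1)^-1 <= 2 - (m%:R + 2^-1)^-1 :> R.
Proof.
elim: m => [|m IHm]; first by rewrite big_ord0 add0r invrK subrr.
rewrite big_ord_recr /=; apply: le_trans (lerD IHm (lexx _)) _.
have m0 : 0 <= m%:R :> R by [].
rewrite natrX -[m.+1%:R]natr1.
rewrite -subr_ge0.
set z : R := m%:R in m0 *.
have -> : 2 - (z + 1 + 2^-1)^-1 - (2 - (z + 2^-1)^-1 + ((z + 1) ^+ 2 - 8^-1)^-1)
 = 8^-1 / (((z + 1) ^+ 2 - 8^-1) * (z + 2^-1) * (z + 1 + 2^-1)).
  by field; rewrite ?gt_eqF //; nra.
by rewrite divr_ge0 ?mulr_ge0 //; nra.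
Qed.

Lemma prod_node0 m :
  3 / 4 <= (\prod_(i < m) (1 - 8^-1 / (i.+1 ^ 2)%:R) : R) <= 1.
Proof.
have q0 (x : R) : 0 <= x -> 0 <= (x + 2^-1)^-1 by move=> x0; rewrite invr_ge0; lra.
(* The extra term, 1/4 at m = 0, makes the bound inductive: a factor 1 - u costs at most u, and u is
   at most the drop of this term. *)
suff : 3 / 4 + 8^-1 * (m%:R + 2^-1)^-1 <= (\prod_(i < m) (1 - 8^-1 / (i.+1 ^ 2)%:R) : R) <= 1.
  by move=> /andP[h ->]; have := q0 m%:R; rewrite ler0n => /(_ isT); lra.
elim: m => [|m /andP[h1 h2]]; first by rewrite big_ord0 add0r invrK; lra.
rewrite big_ord_recr /=.
set P := \prod_(_ < _) _ in h1 h2 *.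
have m0 : 0 <= m%:R :> R by [].
rewrite natrX -[m.+1%:R]natr1.
set z : R := m%:R in m0 h1 *.
set u := _ / _ ^+ 2.
have u0 : 0 <= u by rewrite divr_ge0 ?sqr_ge0 // invr_ge0.
have u1 : u <= 8^-1 * (z + 2^-1)^-1 - 8^-1 * (z + 1 + 2^-1)^-1.
  rewrite -subr_ge0 /u.
  have -> : 8^-1 * (z + 2^-1)^-1 - 8^-1 * (z + 1 + 2^-1)^-1 - 8^-1 / (z + 1) ^+ 2
   = 32^-1 / ((z + 1) ^+ 2 * (z + 2^-1) * (z + 1 + 2^-1)).
    by field; rewrite ?gt_eqF //; nra.
  by rewrite divr_ge0 ?mulr_ge0 ?sqr_ge0 //; lra.
have P0 : 0 <= P.
  by have := q0 z m0; lra.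
apply/andP; split; nra.
Qed.
End Interpolation.

(** * Factorial estimates for the weights of the square nodes *)

Lemma prod_fact_shift c n : ((\prod_(i < n) (c + i).+1) * c`! = (c + n)`!)%N.
Proof.
elim: n => [|n IHn]; first by rewrite big_ord0 mul1n addn0.
by rewrite big_ord_recr /= mulnAC IHn mulnC addnS factS.
Qed.

Lemma prod_fact_rev n : (\prod_(i < n) (n - i) = n`!)%N.
Proof.
by elim: n => [|n IHn]; rewrite ?big_ord0 // big_ord_recl /= subn0 IHn factS.
Qed.

Lemma prod_fact0 n : (\prod_(i < n) i.+1 = n`!)%N.
Proof. by rewrite -(prod_fact_shift 0 n) muln1. Qed.

(** Compare the e factors of (c+e)!/c! with those of (c+2e)!/(c+e)! one by one. *)
Lemma fact_log_convex c e : ((c + e)`! ^ 2 <= c`! * (c + e + e)`!)%N.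
Proof.
rewrite -(prod_fact_shift (c + e) e) mulnA -mulnn leq_pmul2r ?fact_gt0 //.
rewrite -(prod_fact_shift c e) mulnC leq_mul2l leq_prod ?orbT // => i _.
by rewrite ltnS leq_add2r leq_addr.
Qed.

Section Weights.
Variable R : realType.

(** The absolute Lagrange weight at 0 of the node (j+1)^2 among 1, 4, ..., m^2, without the node
    1/8. *)
Definition gap_prod (m j : nat) : R :=
  \prod_(i < m | i != j :> nat) ((i.+1 ^ 2)%:R / `|(i.+1 ^ 2)%:R - (j.+1 ^ 2)%:R|).

(** Differences of squares factor, whence the value 2 m!^2 / ((m-j-1)! (m+j+1)!) for m = j+1+d. The
    induction adds the nodes above (j+1)^2. *)
Lemma gap_prodE j d :
  gap_prod (j.+1 + d) j * (d`! * (j.+1 + d + j.+1)`!)%:R = (2 * (j.+1 + d)`! ^ 2)%:R.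
Proof.
elim: d => [|d IHd].
  rewrite addn0 /gap_prod big_mkcond big_ord_recr /= eqxx mulr1 -big_mkcond /=.
  rewrite (eq_bigl xpredT) => [|i]; last by rewrite ltn_eqF.
  pose P := (\prod_(i < j) (j.+1 + i).+1)%N.
  have PE : (P * j.+1`! = (j.+1 + j)`!)%N by exact: prod_fact_shift.
  have -> : \prod_(i < j) ((i.+1 ^ 2)%:R / `|(i.+1 ^ 2)%:R - (j.+1 ^ 2)%:R|) =
       (j`! ^ 2)%:R / (j`! * P)%:R :> R.
    rewrite (eq_bigr (fun i : 'I_j => (i.+1 ^ 2)%:R / ((j - i) * (j.+1 + i).+1)%:R)).
      by rewrite prodf_div -!natr_prod !big_split /= prod_fact_rev prod_fact0 mulnn.
    move=> i _; congr (_ / _); have ij := ltn_ord i.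
    rewrite distrC ger0_norm ?subr_ge0 ?ler_nat ?leq_sqr ?ltnS ?(ltnW ij) //.
    by rewrite -natrB ?leq_sqr ?ltnS ?(ltnW ij) // subn_sqr; congr (_%:R); lia.
  rewrite fact0 mul1n addnS factS -PE factS.
  have f0 : (j`!)%:R != 0 :> R by rewrite pnatr_eq0 -lt0n fact_gt0.
  have P0 : P%:R != 0 :> R.
    by rewrite pnatr_eq0 -lt0n; have := fact_gt0 (j.+1 + j); rewrite -PE muln_gt0 => /andP[].
  have -> : ((j.+1 + j).+1 = 2 * j.+1)%N by lia.
  rewrite !natrM; field.
  by rewrite f0 P0.
move: IHd; rewrite [(j.+1 + d.+1)%N]addnS; move aE: (j.+1 + d)%N => a IHd.
rewrite /gap_prod big_mkcond big_ord_recr /= -big_mkcond -/(gap_prod _ _).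
rewrite gtn_eqF /=; last by rewrite -aE leq_addr.
have -> : `|(a.+1 ^ 2)%:R - (j.+1 ^ 2)%:R| = (d.+1 * (a + j.+1).+1)%:R :> R.
  rewrite ger0_norm ?subr_ge0 ?ler_nat ?leq_sqr; last by lia.
  by rewrite -natrB ?leq_sqr; [rewrite subn_sqr; congr (_%:R); lia | lia].
rewrite addSn; move: IHd; move: (a + j.+1)%N => b IHd.
rewrite (factS a) (factS b) (factS d).
transitivity ((gap_prod a j * (d`! * b`!)%:R) * (a.+1 ^ 2)%:R).
  by rewrite !natrM; field; rewrite !nat1r !pnatr_eq0.
by rewrite IHd -natrM expnMn; congr (_%:R); ring.
Qed.

Lemma gap_prod_le2 m j : (j < m)%N -> gap_prod m j <= 2.
Proof.
move=> jm; rewrite -(subnKC jm); set d := (m - _)%N.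
have := fact_log_convex d j.+1; rewrite (addnC d).
have := gap_prodE j d; have := fact_gt0 d; have := fact_gt0 (j.+1 + d + j.+1).
move: (_ + j.+1)`! (j.+1 + d)`! (d`!) => v q u v0 u0 e.
rewrite -(ler_nat R) => h.
have p0 : 0 < (u * v)%:R :> R by rewrite ltr0n muln_gt0 u0.
by rewrite -(ler_pM2r p0) e natrM ler_wpM2l.
Qed.

(** The node 1/8 contributes at most 4/3, by [prod_node0]; the others at most (1/4) * 2 in total, by
    [gap_prod_le2] and [sum_inv_sqr]. *)
Lemma node_weights m :
  \sum_(i < m.+1) `|\prod_(j < m.+1 | j != i) (node R j / (node R j - node R i))|
    <= 11 / 6.
Proof.
rewrite big_ord_recl.
have h0 : `|\prod_(j < m.+1 | j != ord0) (node R j / (node R j - 8^-1))| <= 4 / 3.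
  rewrite big_mkcond big_ord_recl /= mul1r.
  have /andP[h1 h2] := prod_node0 R m.
  have -> : \prod_(i < m) ((i.+1 ^ 2)%:R / ((i.+1 ^ 2)%:R - 8^-1)) =
     (\prod_(i < m) (1 - 8^-1 / (i.+1 ^ 2)%:R))^-1 :> R.
    rewrite -prodfV; apply: eq_bigr => i _.
    have i0 : 1 <= (i.+1 ^ 2)%:R :> R by rewrite ler1n expn_gt0.
    move: (_ ^ 2)%:R i0 => z z1; field; rewrite !gt_eqF //; lra.
  have P0 : 0 < \prod_(i < m) (1 - 8^-1 / (i.+1 ^ 2)%:R) :> R by lra.
  rewrite ger0_norm ?invr_ge0 ?(ltW P0) // -[4 / 3]invrK lef_pV2 ?posrE //; lra.
have h1 (i : 'I_m) : `|\prod_(j < m.+1 | j != lift ord0 i)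
    (node R j / (node R j - node R (lift ord0 i)))| <=
    4^-1 * ((i.+1 ^ 2)%:R - 8^-1)^-1.
  rewrite big_mkcond big_ord_recl /= normrM.
  have i0 : 1 <= (i.+1 ^ 2)%:R :> R by rewrite ler1n expn_gt0.
  have -> : `|8^-1 / (8^-1 - (i.+1 ^ 2)%:R)| = 8^-1 * ((i.+1 ^ 2)%:R - 8^-1)^-1 :> R.
    rewrite normrM !normfV distrC !gtr0_norm //; lra.
  rewrite -big_mkcond normr_prod.
  have := gap_prod_le2 (ltn_ord i); rewrite /gap_prod.
  rewrite (eq_bigr (fun j : 'I_m => `|(j.+1 ^ 2)%:R / ((j.+1 ^ 2)%:R - (i.+1 ^ 2)%:R)|)); last first.
    by move=> j _; rewrite normrM normfV ger0_norm.
  have q0 : 0 <= ((i.+1 ^ 2)%:R - 8^-1)^-1 :> R by rewrite invr_ge0; lra.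
  nra.
apply: le_trans (lerD h0 (ler_sum _ (fun i _ => h1 i))) _.
rewrite -mulr_sumr.
have := sum_inv_sqr R m.
have : 0 <= (m%:R + 2^-1)^-1 :> R by rewrite invr_ge0 addr_ge0 // invr_ge0.
lra.
Qed.

(* Lagrange interpolation at 0 from the nodes 1/8, 1, 4, ..., m^2, moved to
   [-1, 1] by z |-> 1 - 2z/m^2, so that 0 goes to 1. *)
Lemma interpolation_weights m : (0 < m)%N ->
  exists w t : 'I_m.+1 -> R,
  [/\ forall s, (s <= m)%N -> \sum_i w i * t i ^+ s = 1,
      \sum_i `|w i| <= 11 / 6 &
      forall i, -1 <= t i <= 1 - 4^-1 / (m ^ 2)%:R].
Proof.
move=> m0; have M0 : 0 < (m ^ 2)%:R :> R by rewrite ltr0n expn_gt0 m0.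
exists (fun i => \prod_(j < m.+1 | j != i) (node R j / (node R j - node R i))).
exists (fun i => 1 - 2 / (m ^ 2)%:R * node R i).
split.
- move=> s sm.
  (* p is 1 at 0 and t_i^s at the i-th node, with degree at most s. *)
  pose p : {poly R} := (1 - (2 / (m ^ 2)%:R) *: 'X) ^+ s.
  have sp : (size p <= m.+1)%N.
    apply: leq_trans (size_poly_exp_leq _ _) _; rewrite ltnS.
    apply: leq_trans sm; rewrite -[leqRHS]mul1n leq_mul2r; apply/orP; right.
    rewrite -subn1 leq_subLR; apply: leq_trans (size_polyD _ _) _.
    rewrite geq_max size_poly1 size_polyN /=.
    by rewrite (leq_trans (size_scale_leq _ _)) ?size_polyX.
  have pE x : p.[x] = (1 - 2 / (m ^ 2)%:R * x) ^+ s.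
    by rewrite /p horner_exp !hornerE.
  have := lagrange_at0 (@node_inj R) sp; rewrite pE mulr0 subr0 expr1n => e; rewrite [RHS]e.
  by apply: eq_bigr => i _; rewrite pE.
- exact: node_weights.
- move=> i.
  have /andP[n1 n2] : 8^-1 <= node R i <= (m ^ 2)%:R.
    case: i => -[|i] /= im; last rewrite ler_nat leq_sqr -ltnS im andbT.
      have : 1 <= (m ^ 2)%:R :> R by rewrite ler1n expn_gt0 m0.
      lra.
    have : 1 <= (i.+1 ^ 2)%:R :> R by rewrite ler1n expn_gt0.
    lra.
  have q0 : 0 < ((m ^ 2)%:R)^-1 :> R by rewrite invr_gt0.
  have : node R i / (m ^ 2)%:R <= 1 by rewrite ler_pdivrMr ?mul1r.
  nra.
Qed.
End Weights.

(** * Embedding into disjointness *)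

Fixpoint literals k : cube k -> seq bool :=
  if k is k'.+1 then
    fun x => [:: x.1.1, x.1.2, ~~ x.1.1, ~~ x.1.2 & literals x.2]
  else fun _ => [::].

(** One-hot code of the designated literal, in the order of [literals]. *)
Fixpoint selectors k : cube k -> seq bool :=
  if k is k'.+1 then
    fun y => [:: ~~ y.1.1 && ~~ y.1.2, y.1.1 && ~~ y.1.2,
                 ~~ y.1.1 && y.1.2, y.1.1 && y.1.2 & selectors y.2]
  else fun _ => [::].

Lemma or_literals_selectors k n (x y : cube k) : (4 * k <= n)%N ->
  \big[orb/false]_(i < n) (nth false (literals x) i && nth false (selectors y) i) =
  overlap x y.
Proof.
elim: k n x y => [|k IHk] n x y; first by rewrite big1 // => i _; rewrite nth_nil.
rewrite mulnS => kn; rewrite -(subnKC (leq_trans (leq_addr _ _) kn)).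
rewrite !big_ord_recl /= IHk ?leq_subRL ?(leq_trans (leq_addr _ _) kn) //.
by rewrite /hit; case: x y => [[[] []] x] [[[] []] y].
Qed.

(** Coordinates past the end are [false] and create no intersection. *)
Definition pad n (s : seq bool) : n.-tuple bool := [tuple nth false s i | i < n].

Lemma DISJ_pad k n (x y : cube k) : (4 * k <= n)%N ->
  DISJ (pad n (literals x)) (pad n (selectors y)) = overlap x y.
Proof.
move=> kn; rewrite -(or_literals_selectors x y kn).
by apply: eq_bigr => i _; rewrite !tnth_mktuple.
Qed.

(** * The dual witness *)

Section Dual.
Variable R : realType.

Lemma sum_enum_val (T : finType) (F : T -> R) :
  \sum_(i < #|T|) F (enum_val i) = \sum_x F x.
Proof. by rewrite -(big_enum_val F); apply: eq_bigl. Qed.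

Lemma opsq_enum (X Y : finType) (W : X -> Y -> R) L : opsq W L ->
  opsq (fun (i : 'I_#|X|) (j : 'I_#|Y|) => W (enum_val i) (enum_val j)) L.
Proof.
move=> hW v.
have E (F : Y -> R -> R) : \sum_j F (enum_val j) (v j) = \sum_y F y (v (enum_rank y)).
  rewrite -(sum_enum_val (fun y => F y (v (enum_rank y)))).
  by apply: eq_bigr => j _; rewrite enum_valK.
rewrite (E (fun _ z => z ^+ 2)).
under eq_bigr => i _ do rewrite (E (fun y z => W (enum_val i) y * z)).
rewrite (sum_enum_val (fun x => (\sum_y W x y * v (enum_rank y)) ^+ 2)).
exact: hW.
Qed.

Lemma bernoulli_inv (q : R) k : 0 <= q <= 1 -> (1 - q) ^+ k * (1 + k%:R * q) <= 1.
Proof.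
move=> /andP[q0 q1]; elim: k => [|k IHk]; first by rewrite mul0r addr0 mulr1.
have p0 : 0 <= (1 - q) ^+ k by rewrite exprn_ge0 ?subr_ge0.
have k0 : 0 <= k%:R :> R by [].
have : 0 <= (1 - q) ^+ k * (q ^+ 2 * (k%:R + 1)).
  by rewrite !mulr_ge0 ?sqr_ge0 // addr_ge0.
rewrite [_ ^+ k.+1]exprS -[k.+1%:R]natr1; lra.
Qed.

(* The mass given to disjoint pairs by the distribution [pat (GRing.exp t)],
   of total mass 16^k. *)
Definition disj_mass k (t : R) : R := (8 * (1 + t)) ^+ k.

Lemma disj_mass_small m k (t : R) : (0 < m)%N -> (80 * m ^ 2 <= k)%N ->
  -1 <= t <= 1 - 4^-1 / (m ^ 2)%:R -> 0 <= disj_mass k t <= 16 ^+ k / 11.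
Proof.
move=> m0 km /andP[t1 t2].
have M1 : 1 <= (m ^ 2)%:R :> R by rewrite ler1n expn_gt0 m0.
have M0 : 0 < (m ^ 2)%:R :> R by lra.
rewrite exprn_ge0 /=; last lra.
(* With this q, 1 + t <= 2 (1 - q), and 80 m^2 <= k gives kq >= 10. *)
pose q : R := 8^-1 / (m ^ 2)%:R.
have qM : q * (m ^ 2)%:R = 8^-1 by rewrite /q divfK ?gt_eqF.
have q0 : 0 <= q by rewrite divr_ge0 ?invr_ge0.
have q1 : q <= 1 by rewrite ler_pdivrMr //; lra.
have kq : 10 <= k%:R * q.
  apply: (@le_trans _ _ ((80 * m ^ 2)%:R * q)); first by rewrite natrM; lra.
  by rewrite ler_wpM2r // ler_nat.
have p0 : 0 <= (1 - q) ^+ k by rewrite exprn_ge0 ?subr_ge0.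
have h : (1 - q) ^+ k <= 11^-1.
  have := @bernoulli_inv q k; rewrite q0 q1 => /(_ isT); nra.
apply: (@le_trans _ _ ((16 * (1 - q)) ^+ k)).
  by apply: lerXn2r; rewrite ?nnegrE /q; lra.
by rewrite exprMn ler_wpM2l ?exprn_ge0.
Qed.

(** The weights are nonnegative of total 16^k, so replacing B by 2/3 of the sign matrix costs at
    most a third of this total. *)
Lemma pat_correlation k (t : R) (B : cube k -> cube k -> R) : -1 <= t <= 1 ->
  (forall x y, `|B x y - 2 / 3 * (-1) ^+ ~~ overlap x y| <= 3^-1) ->
  `|\sum_x \sum_y B x y * pat (GRing.exp t) x y
    - 2 / 3 * (16 ^+ k - 2 * disj_mass k t)| <= 3^-1 * 16 ^+ k.
Proof.
move=> ht hB.
rewrite /disj_mass -sum_pat_exp_disj -(sum_pat_exp k t).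
rewrite !mulr_sumr -sumrB !mulr_sumr -sumrB.
apply: le_trans (ler_norm_sum _ _ _) _; apply: ler_sum => x _.
rewrite !mulr_sumr -sumrB !mulr_sumr -sumrB.
apply: le_trans (ler_norm_sum _ _ _) _; apply: ler_sum => y _.
have p0 := pat_exp_ge0 x y ht.
have -> : B x y * pat (GRing.exp t) x y
   - 2 / 3 * (pat (GRing.exp t) x y - 2 * ((~~ overlap x y)%:R * pat (GRing.exp t) x y))
   = (B x y - 2 / 3 * (-1) ^+ ~~ overlap x y) * pat (GRing.exp t) x y.
  by case: overlap => /=; ring.
by rewrite normrM (ger0_norm p0) ler_wpM2r.
Qed.

Lemma dual_witness m k : (0 < m)%N -> (80 * m ^ 2 <= k)%N ->
  exists2 W : cube k -> cube k -> R, opsq W (9 / 2 ^+ m.+1 * 16 ^+ k) &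
  forall B : cube k -> cube k -> R,
    (forall x y, `|B x y - 2 / 3 * (-1) ^+ ~~ overlap x y| <= 3^-1) ->
    6^-1 * 16 ^+ k <= - \sum_x \sum_y B x y * W x y.
Proof.
move=> m0 km; have [w [t [wt w1 ht]]] := interpolation_weights R m0.
have t1 i : -1 <= t i <= 1.
  have /andP[-> /= h] := ht i; apply: le_trans h _.
  by rewrite gerBl divr_ge0 ?invr_ge0.
pose c s := 1 * 1 ^+ s + (-1) * \sum_i w i * t i ^+ s.
exists (pat c).
  apply: opsq_pat => s; rewrite mulrAC ler_pdivlMr ?exprn_gt0 //.
  have [sm|ms] := leqP s m.
    rewrite /c wt // expr1n mul1r mulN1r subrr expr0n mul0r.
    by rewrite mulr_ge0 ?exprn_ge0.
  (* Above order m: |c_s| <= 1 + 11/6 < 3, and 2^(m+1) <= 2^s. *)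
  apply: ler_pM; rewrite ?sqr_ge0 ?exprn_ge0 ?ler_weXn2l ?ler1n //.
  have : `|\sum_i w i * t i ^+ s| <= 11 / 6.
    apply: le_trans (ler_norm_sum _ _ _) _; apply: le_trans w1.
    apply: ler_sum => i _; rewrite normrM -[leRHS]mulr1 ler_wpM2l //.
    by rewrite normrX exprn_ile1 // ler_norml t1.
  rewrite /c expr1n ler_norml; nra.
move=> B hB.
have -> : \sum_x \sum_y B x y * pat c x y =
  \sum_x \sum_y B x y * pat (GRing.exp 1) x y -
  \sum_i w i * \sum_x \sum_y B x y * pat (GRing.exp (t i)) x y.
  under [X in _ - X]eq_bigr do rewrite mulr_sumr.
  rewrite [X in _ - X]exchange_big -sumrB; apply: eq_bigr => x _ /=.
  under [X in _ - X]eq_bigr do rewrite mulr_sumr.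
  rewrite [X in _ - X]exchange_big -sumrB; apply: eq_bigr => y _ /=.
  rewrite /c pat_lin pat_sum mulrDr mulN1r mul1r mulrN mulr_sumr; congr (_ - _).
  by apply: eq_bigr => i _; ring.
have N0 : 0 < 16 ^+ k :> R by rewrite exprn_gt0.
have h1 := @pat_correlation k 1 B _ hB; rewrite lexx in h1.
have {h1} : 3^-1 * 16 ^+ k <= - \sum_x \sum_y B x y * pat (GRing.exp 1) x y.
  have /h1 : (-1 <= 1 :> R) && true by rewrite andbT; lra.
  rewrite /disj_mass (_ : 8 * (1 + 1) = 16 :> R); last lra.
  by rewrite ler_norml; lra.
(* 5/11 = 1/3 + 4/33: the error of B, plus 4/3 of the disjoint mass 1/11. *)
have h2 i : `|w i * (\sum_x \sum_y B x y * pat (GRing.exp (t i)) x y) -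
              w i * (2 / 3 * 16 ^+ k)| <= `|w i| * (5 / 11 * 16 ^+ k).
  rewrite -mulrBr normrM ler_wpM2l //.
  have := pat_correlation (t1 i) hB; have := disj_mass_small m0 km (ht i).
  rewrite !ler_norml; lra.
have h3 : `|\sum_i w i * (\sum_x \sum_y B x y * pat (GRing.exp (t i)) x y) -
            2 / 3 * 16 ^+ k| <= 11 / 6 * (5 / 11 * 16 ^+ k).
  have w0 : \sum_i w i = 1.
    by rewrite -(wt 0%N) //; apply: eq_bigr => i _; rewrite mulr1.
  rewrite [X in `|X|](_ : _ = \sum_i (w i * (\sum_x \sum_y B x y * pat (GRing.exp (t i)) x y)
    - w i * (2 / 3 * 16 ^+ k))); last by rewrite sumrB -mulr_suml w0 mul1r.
  apply: le_trans (ler_norm_sum _ _ _) _.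
  apply: le_trans (ler_sum _ (fun i _ => h2 i)) _.
  by rewrite -mulr_suml ler_wpM2r ?mulr_ge0 ?exprn_ge0 ?invr_ge0.
(* M_1 contributes at least 1/3, and the other terms at least 2/3 - 5/6 = -1/6. *)
move: h3; rewrite ler_norml; lra.
Qed.
End Dual.

(** * Lower bounds *)

(** Here N = 16^k: one factor N comes from the operator norm, the other from the number of entries.
    The constant is 324 = 36 * 9. *)
Lemma complexity_bound (R : realType) m (N s q : R) : 0 < N ->
  6^-1 * N <= - s -> s ^+ 2 <= 9 / 2 ^+ m * N * N * q -> 2 ^+ m <= 324 * q.
Proof.
move=> N0 h1 h2.
have p0 : 0 < 2 ^+ m :> R by rewrite exprn_gt0.
have h3 : 36^-1 * (N * N) <= s ^+ 2.
  have : (6^-1 * N) ^+ 2 <= (- s) ^+ 2 by rewrite ler_sqr ?nnegrE; lra.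
  by rewrite sqrrN; lra.
have NN0 : 0 < N * N by rewrite mulr_gt0.
have : 36^-1 <= 9 / 2 ^+ m * q.
  rewrite -(ler_pM2r NN0); apply: le_trans h3 (le_trans h2 _).
  by rewrite le_eqVlt; apply/orP; left; apply/eqP; ring.
rewrite mulrAC ler_pdivlMr //; lra.
Qed.

Section Approximation.
Variables (R : realType) (n : nat).
Let X : finType := n.-tuple bool.

Section Block.
Variables (k : nat) (A : 'M[R]_(#|X|, #|X|)).

Definition block (x y : cube k) : R :=
  A (enum_rank (pad n (literals x))) (enum_rank (pad n (selectors y))).

Hypothesis kn : (4 * k <= n)%N.
Hypothesis approxA : approximates (2 / 3) (@DISJ n) A.

(** Error 2/3 and modulus at most 1 place the entry, times its sign, in [1/3, 1], the interval of
    center 2/3 and radius 1/3. *)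
Lemma block_close x y : `|block x y - 2 / 3 * (-1) ^+ ~~ overlap x y| <= 3^-1.
Proof.
have := approxA (enum_rank (pad n (literals x))) (enum_rank (pad n (selectors y))).
rewrite mxE !enum_rankK DISJ_pad // -/(block x y) => -[].
by case: overlap => /=; rewrite !ler_norml; lra.
Qed.

Lemma block_le1 x y : block x y ^+ 2 <= 1.
Proof.
have [_] := approxA (enum_rank (pad n (literals x))) (enum_rank (pad n (selectors y))).
by rewrite -/(block x y) -real_normK ?num_real // => h; rewrite exprn_ile1.
Qed.
End Block.

Variables (m : nat) (A : 'M[R]_(#|X|, #|X|)).
Hypotheses (m0 : (0 < m)%N) (mn : (320 * m ^ 2 <= n)%N).
Hypothesis approxA : approximates (2 / 3) (@DISJ n) A.

Let k := (80 * m ^ 2)%N.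
Let kn : (4 * k <= n)%N. Proof. by rewrite /k mulnA. Qed.

Let card2 : #|cube k|%:R ^+ 2 = 16 ^+ k :> R.
Proof. by rewrite card_cube -natrX -expnM mulnC expnM natrX. Qed.

Lemma rank_bound : 2 ^+ m.+1 <= 324 * (\rank A)%:R :> R.
Proof.
have [W hW hB] := dual_witness R m0 (leqnn k).
have h1 := hB _ (block_close kn approxA).
apply: (complexity_bound _ h1); first by rewrite exprn_gt0.
pose f (i : 'I_#|cube k|) := enum_rank (pad n (literals (enum_val i))).
pose g (i : 'I_#|cube k|) := enum_rank (pad n (selectors (enum_val i))).
have := opsq_rank (mxsub f g A) (opsq_enum hW).
have -> : \sum_i \sum_j mxsub f g A i j * W (enum_val i) (enum_val j) =
          \sum_x \sum_y block A x y * W x y.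
  rewrite -[RHS]sum_enum_val; apply: eq_bigr => i _.
  by rewrite -[RHS]sum_enum_val; apply: eq_bigr => j _; rewrite mxE.
move=> h; apply: le_trans h _.
have L0 : 0 <= 9 / 2 ^+ m.+1 * 16 ^+ k :> R.
  by rewrite mulr_ge0 ?divr_ge0 ?exprn_ge0.
apply: ler_pM => //.
- by rewrite mulr_ge0 //; do 2 (apply: sumr_ge0 => ? _); exact: sqr_ge0.
- rewrite ler_wpM2l // -card2.
  apply: (@le_trans _ _ (\sum_(i < #|cube k|) \sum_(j < #|cube k|) 1)).
    by apply: ler_sum => i _; apply: ler_sum => j _; rewrite mxE; exact: block_le1.
  by rewrite !sumr_const card_ord expr2 mulr_natr.
- by rewrite ler_nat mxrank_mxsub.
Qed.

(** The 4^k rows and 4^k columns used have squared norms at most [row_norm B ^+ 2] and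
    [col_norm C ^+ 2]. *)
Lemma gamma2_bound (l : nat) (B : 'M[R]_(#|X|, l)) (C : 'M[R]_(l, #|X|)) :
  B *m C = A -> 2 ^+ m.+1 <= 324 * (row_norm B * col_norm C) ^+ 2 :> R.
Proof.
move=> BC; have [W hW hB] := dual_witness R m0 (leqnn k).
have h1 := hB _ (block_close kn approxA).
apply: (complexity_bound _ h1); first by rewrite exprn_gt0.
pose b (x : cube k) (i : 'I_l) := B (enum_rank (pad n (literals x))) i.
pose c (i : 'I_l) (y : cube k) := C i (enum_rank (pad n (selectors y))).
have := opsq_factor b c hW.
have -> : \sum_x \sum_y (\sum_i b x i * c i y) * W x y =
          \sum_x \sum_y block A x y * W x y.
  apply: eq_bigr => x _; apply: eq_bigr => y _; congr (_ * _).
  by rewrite /block -BC mxE.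
move=> h; apply: le_trans h _.
have L0 : 0 <= 9 / 2 ^+ m.+1 * 16 ^+ k :> R.
  by rewrite mulr_ge0 ?divr_ge0 ?exprn_ge0.
rewrite -[leLHS]mulrA -[leRHS]mulrA ler_wpM2l //.
rewrite -card2 expr2 exprMn mulrACA.
have sum2_ge0 (I J : finType) (a : I -> J -> R) : 0 <= \sum_i \sum_j a i j ^+ 2.
  by do 2 (apply: sumr_ge0 => ? _); exact: sqr_ge0.
apply: ler_pM => //.
- rewrite mulr_natl -sumr_const; apply: ler_sum => x _; exact: row_norm_sqr.
- rewrite exchange_big mulr_natl -sumr_const.
  by apply: ler_sum => y _; exact: col_norm_sqr.
Qed.
End Approximation.

(** * Logarithms and the choice of m for given n *)

Section Asymptotics.
Variable R : realType.

Lemma approx_rank_bound n m : (0 < m)%N -> (320 * m ^ 2 <= n)%N ->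
  2 ^+ m.+1 <= 324 * (approx_rank R (@DISJ n))%:R :> R.
Proof.
move=> m0 mn; rewrite /approx_rank; case: ex_minnP => r /asboolP[A [hA <-]] _.
exact: rank_bound m0 mn hA.
Qed.

(** A lower bound uniform in A and its factorizations passes through both infima. Positivity allows
    the logarithm of the square to be halved. *)
Lemma approx_gamma2_bound n m : (0 < m)%N -> (320 * m ^ 2 <= n)%N ->
  0 < approx_gamma2 R (@DISJ n) /\
  2 ^+ m.+1 <= 324 * approx_gamma2 R (@DISJ n) ^+ 2 :> R.
Proof.
move=> m0 mn.
pose s : R := Num.sqrt (2 ^+ m.+1 / 324).
have p0 : 0 <= 2 ^+ m.+1 :> R by rewrite exprn_ge0.
suff sg : s <= approx_gamma2 R (@DISJ n).
  split; first by rewrite (lt_le_trans _ sg) // sqrtr_gt0 divr_gt0 ?exprn_gt0.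
  have : s ^+ 2 <= approx_gamma2 R (@DISJ n) ^+ 2.
    by rewrite ler_sqr ?nnegrE ?(le_trans _ sg) ?sqrtr_ge0.
  by rewrite sqr_sqrtr ?divr_ge0 // ler_pdivrMr // mulrC.
apply: lb_le_inf.
  exists (gamma2 (sign_mx R (@DISJ n))), (sign_mx R (@DISJ n)) => //=.
  by apply: approximates_sign_mx; rewrite divr_ge0.
move=> _ [A hA <-]; apply: lb_le_inf.
  by eexists; exists #|{: n.-tuple bool}|, A, 1%:M; split; [rewrite mulmx1|].
move=> _ [l [B [C [BC ->]]]].
have := gamma2_bound m0 mn hA BC.
have q0 : 0 <= row_norm B * col_norm C by rewrite mulr_ge0 ?row_norm_ge0 ?col_norm_ge0.
move=> h; rewrite -(ger0_norm q0) -sqrtr_sqr ler_wsqrtr // ler_pdivrMr // mulrC.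
exact: h.
Qed.

Lemma ln2_gt0 : 0 < ln 2 :> R.
Proof. by rewrite ln_gt0 // ltr1n. Qed.

Lemma log2_ge (m : nat) (x : R) : 0 <= x -> 2 ^+ m.+1 <= 324 * x -> m%:R - 8 <= log2 x.
Proof.
move=> x0 h; have p0 : 0 < 2 ^+ m.+1 :> R by rewrite exprn_gt0.
have {}x0 : 0 < x by lra.
(* 324 <= 512 = 2^9, and (m + 1) - 9 = m - 8. *)
have h9 : 2 ^+ m.+1 <= 2 ^+ 9 * x.
  by apply: le_trans h _; rewrite (ler_wpM2r (ltW x0)) // -natrX ler_nat.
rewrite /log2 ler_pdivlMr ?ln2_gt0 //.
have : ln (2 ^+ m.+1) <= ln (2 ^+ 9 * x) :> R.
  by rewrite ler_ln ?posrE ?mulr_gt0 ?exprn_gt0.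
rewrite lnM ?posrE ?exprn_gt0 // !lnXn // -[_ *+ m.+1]mulr_natr -[_ *+ 9]mulr_natr -[m.+1%:R]natr1; lra.
Qed.

(** For the largest admissible m, n < 320 (m+1)^2 <= (18 (m+1))^2. *)
Lemma sqrt_scale n : (320 * 14 ^ 2 <= n)%N ->
  exists m, [/\ (13 <= m)%N, (320 * m ^ 2 <= n)%N &
    Num.sqrt n%:R <= 18 * (m%:R + 1) :> R].
Proof.
move=> hn; have ex : exists m, (320 * m ^ 2 <= n)%N by exists 0%N.
have ub i : (320 * i ^ 2 <= n)%N -> (i <= n)%N.
  by move=> h; apply: leq_trans h; case: i => // i; rewrite -mulnn; nia.
case: (ex_maxnP ex ub) => m hm max.
have lt : (n < 320 * m.+1 ^ 2)%N.
  by rewrite ltnNge; apply/negP => /max; rewrite ltnn.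
exists m; split=> //.
  by apply: leq_trans (max 14%N hn).
rewrite -[leRHS]ger0_norm; last by rewrite mulr_ge0 // addr_ge0.
rewrite -sqrtr_sqr ler_wsqrtr // natr1 -natrM -natrX ler_nat.
by apply: leq_trans (ltnW lt) _; rewrite expnMn leq_mul2r orbT.
Qed.
End Asymptotics.

Theorem theorem3 (R : realType) :
  Omega_sqrt (fun n : nat => log2 ((approx_rank R (@DISJ n))%:R : R)) /\
  Omega_sqrt (fun n : nat => log2 (approx_gamma2 R (@DISJ n))).
Proof.
(* As 108 = 6 * 18, it suffices that (m - 8)/2 >= (m + 1)/6, true from m = 13 on; the halving is for
   gamma_2. *)
split; exists 108^-1; rewrite ?invr_gt0 //; exists (320 * 14 ^ 2)%N => n.
all: move=> /(sqrt_scale R)[m [m13 mn ub]].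
all: have m0 : (0 < m)%N by exact: leq_trans m13.
all: have : 13 <= m%:R :> R by rewrite ler_nat.
- have := log2_ge (ler0n _ _) (approx_rank_bound R m0 mn); lra.
- have [g0 /(log2_ge (sqr_ge0 _))] := approx_gamma2_bound R m0 mn.
  rewrite /log2 lnXn // mulrnAl mulr2n; lra.
Qed.
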